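(* Let $d\in\mathbb{N}$, $\alpha,\mu>0$, let $k\in\mathcal{S}(\mathbb{R}^d)$ be real-valued, let $\kappa=\hat k$, $\kappa^*=\sup_{\xi\in\mathbb{R}^d}\operatorname{Re}\kappa(\xi)$, and suppose $2\alpha-\mu\kappa^*>0$. Let $E\subseteq\mathbb{R}^d$ be thick. Let $f\in C^1(\mathbb{R})$ be globally Lipschitz continuous with $f(0)=0$ and $f'(0)=1$, write $f(\theta)=\theta+g(\theta)$, and let $\Lambda$ be the Lipschitz constant of $g:\mathbb{R}\to\mathbb{R}$. Let $Ka=k*a$, $B=-\alpha\,\mathrm{Id}+\mu K$ and $\mathcal{N}(\phi)=\mu K g(\phi)$ for $\phi\in L^2(\mathbb{R}^d)$. Let $F:L^2(\mathbb{R}^d)\to L^2(\mathbb{R}^d)$ be a bounded linear operator such that the semigroup $(V_t)_{t\ge0}$ generated by $B+\mathbf{1}_EF$ is exponentially stable, with constants $M>0$ and $\omega<0$ such that $\|V_t\|\le Me^{\omega t}$ for all $t>0$. Suppose that $$\gamma=M\mu\|k\|_{L^1(\mathbb{R}^d)}\Lambda+\omega<0.$$ Then for all $a_0\in L^2(\mathbb{R}^d)$ the mild solution $a$ of $$\partial_ta-(B+\mathbf{1}_EF)a=\mathcal{N}(a),\qquad a(0)=a_0,$$ satisfies $$\|a(t)\|_{L^2(\mathbb{R}^d)}\le Me^{\gamma t}\|a_0\|_{L^2(\mathbb{R}^d)}\qquad\text{for all }t\in(0,\infty).$$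
   Context: Here $L^2(\mathbb{R}^d)$ consists of real-valued functions; all sets and functions are Lebesgue measurable. $\mathbf{1}_E$ is the indicator function of $E$ (also the corresponding multiplication operator), $\mathcal{S}(\mathbb{R}^d)$ is the Schwartz space, $\hat f(\xi)=\int_{\mathbb{R}^d}e^{-\mathrm{i}x\cdot\xi}f(x)\,dx$, and $g(\phi)$ denotes the composition $x\mapsto g(\phi(x))$. Thick set: let $\Pi_L$ be the cube of sidelength $L$ centered at $0\in\mathbb{R}^d$. $E\subseteq\mathbb{R}^d$ is $(L,\rho)$-thick if its intersection with $\Pi_L+x$ has Lebesgue measure at least $\rho L^d$ for all $x\in\mathbb{R}^d$. $E$ is thick if it is $(L,\rho)$-thick for some $L,\rho>0$. The operator $\mathcal{N}:L^2(\mathbb{R}^d)\to L^2(\mathbb{R}^d)$ is globally Lipschitz continuous. The mild solution for initial value $a_0$ is the unique continuous function $a:[0,\infty)\to L^2(\mathbb{R}^d)$ satisfying $$a(t)=V_ta_0+\int_0^tV_{t-s}\mathcal{N}(a(s))\,ds\qquad\text{for all }t\in[0,\infty).$$ *)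

(* Defs.v *)
From HB Require Import structures.
From mathcomp Require Import all_boot all_order all_algebra.
From mathcomp Require Import complex.
From mathcomp Require Import all_classical all_reals all_analysis.
From mathcomp Require Import measurable_realfun ess_sup_inf.

Set Implicit Arguments.
Unset Strict Implicit.
Unset Printing Implicit Defensive.

Import Order.TTheory GRing.Theory Num.Theory.
Import numFieldNormedType.Exports.

Local Open Scope classical_set_scope.
Local Open Scope ring_scope.

Definition rV_display : measure_display.
Proof. exact: default_measure_display. Qed.

Section measurable_rV.
Context (R : realType) (n : nat).

Definition rV_coord (i : 'I_n) (x : 'rV[R]_n) : R := x ord0 i.

Let rV_set0 : g_sigma_preimage rV_coord set0.
Proof. exact: sigma_algebra0. Qed.

Let rV_setC A : g_sigma_preimage rV_coord A -> g_sigma_preimage rV_coord (~` A).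
Proof. exact: sigma_algebraC. Qed.

Let rV_bigcup (F : _^nat) : (forall i, g_sigma_preimage rV_coord (F i)) ->
  g_sigma_preimage rV_coord (\bigcup_i (F i)).
Proof. exact: sigma_algebra_bigcup. Qed.

HB.instance Definition _ := @isMeasurable.Build rV_display
  'rV[R]_n (g_sigma_preimage rV_coord) rV_set0 rV_setC rV_bigcup.

Lemma measurable_rV_coord (i : 'I_n) : measurable_fun setT (rV_coord i).
Proof.
move=> _ Y mY; rewrite setTI; apply: sub_sigma_algebra => /=.
rewrite -bigcup_seq/=; exists i => /=; first by rewrite mem_index_enum.
by exists Y => //; rewrite setTI.
Qed.

Lemma measurable_fun_rV d (T : measurableType d) (f : T -> 'rV[R]_n) :
  (forall i, measurable_fun setT (fun x => f x ord0 i)) -> measurable_fun setT f.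
Proof.
move=> mf; apply: (@measurability _ _ _ _ _ _
  (\big[setU/set0]_(i < n) preimage_set_system setT (rV_coord i) measurable)) => //.
move=> _ [B + <-]; rewrite -bigcup_seq => -[i _ [C mC <-]].
by rewrite setTI; have := mf i measurableT C mC.
Qed.

End measurable_rV.

Section lebesgue_rV_step.
Context (R : realType) (n : nat).
Variable mu : {sigma_finite_measure set 'rV[R]_n -> \bar R}.

Definition consrV (x : measurableTypeR R * 'rV[R]_n) : 'rV[R]_n.+1 :=
  row_mx (x.1%:M : 'rV[R]_1) x.2.

Definition unconsrV (y : 'rV[R]_n.+1) : measurableTypeR R * 'rV[R]_n :=
  (y ord0 ord0, rsubmx (y : 'rV[R]_(1 + n))).

Lemma consrVK : cancel consrV unconsrV.
Proof.
move=> [a x]; rewrite /unconsrV /consrV /= row_mxKr; congr (_, _).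
have -> : (ord0 : 'I_n.+1) = lshift n (ord0 : 'I_1) by apply/val_inj.
by rewrite (@row_mxEl _ 1 1 n) mxE eqxx mulr1n.
Qed.

Lemma measurable_consrV : measurable_fun setT consrV.
Proof.
apply: measurable_fun_rV => i; have [j|j] := split_ordP (i : 'I_(1 + n)) => ->.
  rewrite (_ : (fun _ => _) = fst); first exact: measurable_fst.
  by apply/funext => x; rewrite (@row_mxEl _ 1 1 n) (ord1 j) mxE eqxx mulr1n.
rewrite (_ : (fun _ => _) = @rV_coord R n j \o snd).
  exact: (measurableT_comp (measurable_rV_coord j) measurable_snd).
by apply/funext => x; rewrite (@row_mxEr _ 1 1 n).
Qed.

Lemma measurable_unconsrV : measurable_fun setT unconsrV.
Proof.
apply/measurable_fun_pairP; split; first exact: (@measurable_rV_coord R n.+1 ord0).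
apply: measurable_fun_rV => i.
rewrite (_ : (fun _ => _) = @rV_coord R n.+1 (rshift 1 i)).
  exact: measurable_rV_coord.
by apply/funext => x; rewrite /= mxE.
Qed.

Definition lebesgue_rVS : set 'rV[R]_n.+1 -> \bar R :=
  pushforward (@lebesgue_measure R \x mu)%E consrV.

HB.instance Definition _ := Measure.copy lebesgue_rVS
  (measure_function_pushforward__canonical__measure_function_Measure
    (@lebesgue_measure R \x mu)%E measurable_consrV).

Let lebesgue_rVS_sigma_finite : sigma_finite setT lebesgue_rVS.
Proof.
have /sigma_finiteP[F [TF ndF Foo]] := sigma_finiteT (@lebesgue_measure R).
have /sigma_finiteP[G [TG ndG Goo]] := sigma_finiteT mu.
exists (fun k => unconsrV @^-1` (F k `*` G k)).
  rewrite -preimage_bigcup; apply/esym/seteqP; split=> // y _ /=.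
  have : [set: measurableTypeR R] (unconsrV y).1 by [].
  have : [set: 'rV[R]_n] (unconsrV y).2 by [].
  rewrite {1}TF {1}TG => -[k _ Gk] [l _ Fl]; exists (maxn l k) => //; split.
    by move: Fl; exact/subsetPset/ndF/leq_maxl.
  by move: Gk; exact/subsetPset/ndG/leq_maxr.
move=> k; have [mF Fk] := Foo k; have [mG Gk] := Goo k; split.
  rewrite -[X in measurable X]setTI.
  by apply: measurable_unconsrV => //; exact: measurableX.
rewrite /lebesgue_rVS /pushforward -comp_preimage.
rewrite (_ : unconsrV \o consrV = id); last first.
  by apply/funext => x /=; rewrite consrVK.
by rewrite preimage_id product_measure1E// lte_mul_pinfty// ge0_fin_numE.
Qed.

HB.instance Definition _ := Measure_isSigmaFinite.Build _ _ _ lebesgue_rVS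
  lebesgue_rVS_sigma_finite.

End lebesgue_rV_step.

(* The product of [n] copies of the one-dimensional Lebesgue measure, on the
   product sigma-algebra; see [lebesgue_rV_prod]. *)
Fixpoint lebesgue_rV (R : realType) (n : nat) :
    {sigma_finite_measure set 'rV[R]_n -> \bar R} :=
  if n is m.+1 then lebesgue_rVS (lebesgue_rV R m)
  else \d_(0 : 'rV[R]_0).

Lemma lebesgue_rV_prod (R : realType) (n : nat) (A : 'I_n -> set R) :
  (forall i, measurable (A i)) ->
  lebesgue_rV R n [set x | forall i, A i (x ord0 i)] =
  (\prod_(i < n) lebesgue_measure (A i))%E.
Proof.
elim: n A => [|n IHn] A mA.
  rewrite big_ord0; transitivity (lebesgue_rV R 0 setT); last exact: diracT.
  by congr (_ _); apply/seteqP; split=> // x _ [].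
have mB : measurable [set x : 'rV[R]_n | forall i, A (lift ord0 i) (x ord0 i)].
  rewrite (_ : [set _ | _] =
      \bigcap_(i in [set: 'I_n]) (@rV_coord R n i @^-1` A (lift ord0 i))).
    apply: fin_bigcap_measurable => // i _; rewrite -[X in measurable X]setTI.
    exact: measurable_rV_coord.
  by apply/seteqP; split=> [x Ax i _|x Ax i]; apply: Ax.
rewrite big_ord_recl -IHn// -product_measure1E//; last exact: mA.
change ((@lebesgue_measure R \x lebesgue_rV R n)%E
  (@consrV R n @^-1` [set x | forall i, A i (x ord0 i)]) = 
  (@lebesgue_measure R \x lebesgue_rV R n)%E
   (A ord0 `*` [set x : 'rV[R]_n | forall i, A (lift ord0 i) (x ord0 i)])).
have consrV0 x : (@consrV R n x) ord0 ord0 = x.1.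
  exact: (congr1 fst (consrVK x)).
have consrVS x (i : 'I_n) : (@consrV R n x) ord0 (lift ord0 i) = x.2 ord0 i.
  rewrite /consrV (_ : lift ord0 i = rshift 1 i); last exact: val_inj.
  by rewrite (@row_mxEr _ 1 1 n).
congr (_ _); apply/seteqP; split=> [x Ax|x [A0 Ax] i] /=.
  by split => [|i]; [rewrite -consrV0|rewrite -consrVS]; exact: Ax.
by have [j ->|->] := unliftP ord0 i; [rewrite consrVS; exact: Ax|rewrite consrV0].
Qed.

(* [LspaceType] is the library's quotient of the [L^p] functions by almost
   everywhere equality, which comes without an algebraic structure. *)
Section Lspace_normedModType.
Local Open Scope quotient_scope.
Context d (T : measurableType d) (R : realType).
Variables (mu : {measure set T -> \bar R}) (p : \bar R) (p1 : (1 <= p)%E).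
Local Notation Lp := (LspaceType mu p1).
Local Notation Lf := (LfunType mu p1).
Implicit Types (f g h : Lf) (u v w : Lp).

HB.instance Definition _ := gen_eqMixin Lp.
HB.instance Definition _ := gen_choiceMixin Lp.

Lemma ae_eq_Lnorm (f g : T -> R) : measurable_fun setT f -> measurable_fun setT g ->
  f = g %[ae mu] -> 'N[mu]_p[EFin \o f]%E = 'N[mu]_p[EFin \o g]%E.
Proof.
move=> mf mg fg; rewrite unlock; case: p p1 => [r _|_|//].
  congr (_ `^ _)%E; apply: ae_eq_integral => //.
  - apply/measurable_EFinP; apply: (measurableT_comp (measurable_powR r)).
    exact: measurableT_comp.
  - apply/measurable_EFinP; apply: (measurableT_comp (measurable_powR r)).
    exact: measurableT_comp.
  - by apply: filterS fg => x /= fgx _; rewrite fgx.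
case: ifP => // _; apply: eq_ess_sup.
by apply: filterS fg => x /= fgx; rewrite fgx.
Qed.

Let Lmfun f : {mfun T >-> measurableTypeR R} := MeasurableFun.Pack
  (MeasurableFun.Class
    (@isMeasurableFun.Build _ _ T (measurableTypeR R) f
      (@measurable_funPT _ _ T R f))).

Local Notation Q := {mfun_ mu, T >-> measurableTypeR R}.

Let mfun_of_Q (u : Q) : measurable_fun [set: T] (u : T -> R).
Proof. exact: (@measurable_funPT _ _ T (measurableTypeR R) (repr u)). Qed.

Let reprQ_ae (f : {mfun T >-> measurableTypeR R}) : 
  ((\pi_Q f : Q) : T -> R) = f %[ae mu].
Proof.
have : (\pi_Q (repr (\pi_Q f)) = \pi_Q f :> Q) by rewrite reprK.
by move=> /eqmodP /asboolP.
Qed.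

Let Lclass_finite f : finite_norm mu p (\pi_Q (Lmfun f) : Q).
Proof.
rewrite /finite_norm (@ae_eq_Lnorm _ f)//; first exact: Lfunction_finite.
Qed.

Definition Lclass f : Lp :=
  LebesgueSpace.Pack (LebesgueSpace.Class
    (isFinLebesgue.Build _ _ _ mu p p1 _ (Lclass_finite f))).

Let Lrepr_mfun u : (u : T -> R) \in mfun.
Proof. by rewrite inE; exact: mfun_of_Q. Qed.

Let Lrepr_Lfun u : (u : T -> R) \in Lfun mu p.
Proof. by rewrite inE Lrepr_mfun/= inE; exact: Lebesgue_finite. Qed.

Definition Lrepr u : Lf := Lfun_Sub p1 (Lrepr_Lfun u).

Lemma LreprE u : Lrepr u = u :> (T -> R).
Proof. by []. Qed.

Lemma Lspace_eqP u v : (u : T -> R) = v %[ae mu] <-> u = v.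
Proof.
split=> [uv|->]; last exact: ae_eq_refl.
case: u v uv => [u [[uf]]] [v [[vf]]] /= uv.
have uvE : u = v by rewrite -(reprK u) -(reprK v); apply/eqmodP/asboolP.
move: uf vf uv; rewrite uvE => uf vf _; congr LebesgueSpace.Pack.
by congr LebesgueSpace.Class; congr isFinLebesgue.Axioms_; exact: Prop_irrelevance.
Qed.

Lemma LclassE f : (Lclass f : T -> R) = f %[ae mu].
Proof. exact: (reprQ_ae (Lmfun f)). Qed.

Lemma Lclass_eqP f g : Lclass f = Lclass g <-> (f : T -> R) = g %[ae mu].
Proof.
rewrite -Lspace_eqP; split => fg.
  exact: ae_eq_trans (ae_eq_sym (LclassE f)) (ae_eq_trans fg (LclassE g)).
exact: ae_eq_trans (LclassE f) (ae_eq_trans fg (ae_eq_sym (LclassE g))).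
Qed.

Lemma LreprK : cancel Lrepr Lclass.
Proof. by move=> u; apply/Lspace_eqP; exact: LclassE. Qed.

Let Lzero : Lp := Lclass 0.
Let Lopp u : Lp := Lclass (- Lrepr u).
Let Ladd u v : Lp := Lclass (Lrepr u + Lrepr v).
Let Lscale (a : R) u : Lp := Lclass (a *: Lrepr u).

Let LaddE f g : Ladd (Lclass f) (Lclass g) = Lclass (f + g).
Proof.
apply/Lclass_eqP; apply: filterS2 (LclassE f) (LclassE g) => x fE gE _.
transitivity (Lclass f x + Lclass g x) => //.
by rewrite (fE I) (gE I).
Qed.

Let LscaleE a f : Lscale a (Lclass f) = Lclass (a *: f).
Proof.
apply/Lclass_eqP; apply: filterS (LclassE f) => x fE _.
transitivity (a * Lclass f x) => //.
by rewrite (fE I).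
Qed.

Let LoppE f : Lopp (Lclass f) = Lclass (- f).
Proof.
apply/Lclass_eqP; apply: filterS (LclassE f) => x fE _.
transitivity (- Lclass f x) => //.
by rewrite (fE I).
Qed.

Let LaddA : associative Ladd.
Proof.
by move=> u v w; rewrite -(LreprK u) -(LreprK v) -(LreprK w) !LaddE addrA.
Qed.

Let LaddC : commutative Ladd.
Proof. by move=> u v; rewrite /Ladd addrC. Qed.

Let Ladd0 : left_id Lzero Ladd.
Proof. by move=> u; rewrite -(LreprK u) LaddE add0r. Qed.

Let LaddN : left_inverse Lzero Lopp Ladd.
Proof. by move=> u; rewrite -(LreprK u) LoppE LaddE addNr. Qed.

HB.instance Definition _ := GRing.isZmodule.Build Lp LaddA LaddC Ladd0 LaddN.

Let LscaleA a b u : Lscale a (Lscale b u) = Lscale (a * b) u.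
Proof. by rewrite -(LreprK u) !LscaleE scalerA. Qed.

Let Lscale1 : left_id 1 Lscale.
Proof. by move=> u; rewrite -(LreprK u) LscaleE scale1r. Qed.

Let LscaleDr : right_distributive Lscale +%R.
Proof.
move=> a u v; rewrite -(LreprK u) -(LreprK v).
change (Lscale a (Ladd (Lclass (Lrepr u)) (Lclass (Lrepr v))) =
  Ladd (Lscale a (Lclass (Lrepr u))) (Lscale a (Lclass (Lrepr v)))).
by rewrite LaddE !LscaleE LaddE scalerDr.
Qed.

Let LscaleDl u : {morph Lscale^~ u : a b / a + b}.
Proof.
move=> a b; rewrite -(LreprK u).
change (Lscale (a + b) (Lclass (Lrepr u)) =
  Ladd (Lscale a (Lclass (Lrepr u))) (Lscale b (Lclass (Lrepr u)))).
by rewrite !LscaleE LaddE scalerDl.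
Qed.

HB.instance Definition _ := GRing.Zmodule_isLmodule.Build R Lp
  LscaleA Lscale1 LscaleDr LscaleDl.

Definition Lspace_norm u : R := fine 'N[mu]_p[EFin \o u]%E.

Let Lspace_normE f : Lspace_norm (Lclass f) = fine 'N[mu]_p[EFin \o f]%E.
Proof. by rewrite /Lspace_norm (@ae_eq_Lnorm _ f)//; exact: LclassE. Qed.

Let Lspace_normD u v : Lspace_norm (u + v) <= Lspace_norm u + Lspace_norm v.
Proof.
rewrite -(LreprK u) -(LreprK v) -[X in Lspace_norm X]/(Ladd _ _) LaddE !Lspace_normE.
exact: ler_LnormD.
Qed.

Let Lspace_normZ a u : Lspace_norm (a *: u) = `|a| * Lspace_norm u.
Proof.
rewrite -(LreprK u) -[X in Lspace_norm X]/(Lscale _ _) LscaleE !Lspace_normE.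
by rewrite LnormZ fineM// -finite_norm_fine.
Qed.

Let Lspace_norm_eq0 u : Lspace_norm u = 0 -> u = 0.
Proof.
rewrite -(LreprK u) Lspace_normE => /fine_Lnormr_eq0 u0.
by rewrite -[RHS]/Lzero; apply/Lclass_eqP.
Qed.

HB.instance Definition _ := Lmodule_isNormed.Build R Lp
  Lspace_normD Lspace_normZ Lspace_norm_eq0.

End Lspace_normedModType.

Section operators.
Context (R : realType) (X : normedModType R).

Definition bounded_linear (A : X -> X) : Prop :=
  linear A /\ exists C : R, forall x, `|A x| <= C * `|x|.

Definition opnorm (A : X -> X) : R :=
  sup [set `|A x| | x in [set x : X | `|x| <= 1]].

Definition C0_semigroup (V : R -> X -> X) : Prop :=
  [/\ forall t, 0 <= t -> bounded_linear (V t),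
      forall x, V 0 x = x,
      forall s t, 0 <= s -> 0 <= t -> forall x, V (s + t) x = V s (V t x) &
      forall x, V t x @[t --> 0^'+] --> x].

(* [A] is defined on the whole of [X], so that the domain of the generator
   is the whole of [X] as well. *)
Definition semigroup_generated_by (A : X -> X) (V : R -> X -> X) : Prop :=
  C0_semigroup V /\
  forall x, t^-1 *: (V t x - x) @[t --> 0^'+] --> A x.

(* [s = s_0, ..., s_(m-1)] encodes the partition
   [a < s_0 < ... < s_(m-1) = b], as in [itv_partition]; [tau i] is the tag of
   its [i]-th interval. *)
Definition riemann_sum (a : R) (s : seq R) (tau : nat -> R) (f : R -> X) : X :=
  \sum_(i < size s) (s`_i - (a :: s)`_i) *: f (tau i).

(* For the continuous integrands of mild solutions, this agrees with the
   Bochner integral. *)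
Definition is_integral (a b : R) (f : R -> X) (I : X) : Prop :=
  forall e : R, 0 < e -> exists2 delta : R, 0 < delta &
    forall (s : seq R) (tau : nat -> R),
      itv_partition a b s ->
      (forall i, (i < size s)%N -> s`_i - (a :: s)`_i < delta) ->
      (forall i, (i < size s)%N -> (a :: s)`_i <= tau i <= s`_i) ->
      `|riemann_sum a s tau f - I| < e.

Definition mild_solution (V : R -> X -> X) (N : X -> X) (a0 : X)
    (a : R -> X) : Prop :=
  {within `[0, +oo[, continuous a} /\
  forall t, 0 <= t ->
    exists2 I : X, is_integral 0 t (fun s => V (t - s) (N (a s))) I &
      a t = V t a0 + I.

End operators.

Section real_functions.
Context (R : realType).
Implicit Types f : R -> R.

Definition is_C1 f : Prop :=
  (forall x, derivable f x 1) /\ continuous (derive1 f).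

(* The least Lipschitz constant. *)
Definition lipschitz_constant f : R :=
  inf [set L : R | 0 <= L /\ L.-lipschitz f].

End real_functions.

Section euclidean_space.
Context (R : realType) (d : nat).
Local Notation Rd := 'rV[R]_d.
Local Notation leb := (lebesgue_rV R d).
Implicit Types (k : Rd -> R) (E : set Rd).

(* [partials s k] is the iterated partial derivative of [k] in the coordinate
   directions listed in [s]. *)
Definition partials (s : seq 'I_d) k : Rd -> R :=
  foldr (fun i h x => 'D_(delta_mx ord0 i) h x) k s.

Definition smooth k : Prop :=
  forall s : seq 'I_d,
    continuous (partials s k) /\
    forall i x, derivable (partials s k) x (delta_mx ord0 i).

Definition schwartz k : Prop :=
  smooth k /\
  forall (b : 'I_d -> nat) (s : seq 'I_d), exists C : R, forall x : Rd,
    `|(\prod_i x ord0 i ^+ b i) * partials s k x| <= C.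

Definition dotrV (x y : Rd) : R := \sum_i x ord0 i * y ord0 i.

Definition expi (t : R) : R[i] := (cos t +i* sin t)%C.

Definition integralC (h : Rd -> R[i]) : R[i] :=
  ((\int[leb]_x complex.Re (h x)) +i* (\int[leb]_x complex.Im (h x)))%C.

Definition fourier (h : Rd -> R[i]) (xi : Rd) : R[i] :=
  integralC (fun x => expi (- dotrV x xi) * h x).

(* [leb] lives on the Borel sets; Lebesgue measurability is the Caratheodory
   criterion for the outer measure [leb^*], which on Lebesgue measurable sets is
   the Lebesgue measure. *)
Definition lebesgue_measurable E : Prop := (leb^*)%mu.-cara.-measurable E.

Definition cube (L : R) (x : Rd) : set Rd :=
  [set y | forall i, `|y ord0 i - x ord0 i| <= L / 2].

Definition L_rho_thick (L rho : R) E : Prop :=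
  forall x : Rd, ((rho * L ^+ d)%:E <= (leb^*)%mu (E `&` cube L x))%E.

Definition thick E : Prop :=
  exists L rho : R, [/\ 0 < L, 0 < rho & L_rho_thick L rho E].

(* Every class of Lebesgue measurable functions contains Borel ones, so that
   this is the usual space although [leb] lives on the Borel sets. *)
Definition L2 : normedModType R := LspaceType2 leb.

(* The class of a function that is equal a.e. to a Borel function in [L^2]
   (and [0] for any other function). *)
Definition toL2 (h : Rd -> R) : L2 :=
  xget 0 [set u : L2 | h = (u : LspaceType2 leb) %[ae leb]].

Definition L2fun (u : L2) : Rd -> R := (u : LspaceType2 leb).

Lemma toL2_eq (h : Rd -> R) (u : L2) :
  h = L2fun u %[ae leb] -> toL2 h = u.
Proof.
move=> hu; rewrite /toL2; case: xgetP => [v _ /= hv|/(_ u)]; last by [].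
apply/Lspace_eqP; exact: ae_eq_trans (ae_eq_sym hv) hu.
Qed.

Definition L1norm k : R := fine 'N[leb]_1[EFin \o k]%E.

Definition convolution (k a : Rd -> R) (x : Rd) : R :=
  \int[leb]_y (k (x - y) * a y).

(* [toL2] never falls back to [0] in the three operators below when [k] is
   a Schwartz function, [E] is Lebesgue measurable and [g] is Lipschitz with
   [g 0 = 0]. *)
Definition K_op k (a : L2) : L2 := toL2 (convolution k (L2fun a)).

Definition B_op (alpha mu : R) k (a : L2) : L2 :=
  (- alpha) *: a + mu *: K_op k a.

Definition indicator_op E (a : L2) : L2 := toL2 (\1_E \* L2fun a).

Definition N_op (mu : R) k (g : R -> R) (phi : L2) : L2 :=
  mu *: K_op k (toL2 (g \o L2fun phi)).

End euclidean_space.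

(* Main.v *)
Require Import Defs.
From mathcomp Require Import all_boot all_order all_algebra.
From mathcomp Require Import complex.
From mathcomp Require Import all_classical all_reals all_analysis.
From mathcomp Require Import measurable_realfun ring lra.

(* By Young's inequality and [g 0 = 0], the nonlinearity satisfies
   [|N phi| <= c * |phi|] with [c = mu * |k|_1 * Lambda], so that Duhamel's formula
   gives, for [u t = expR (- omega * t) * |a t|],
     [u t <= M * |a0| + M * c * \int_0^t u].
   Gronwall's lemma then yields [u t <= M * expR (M * c * t) * |a0|]. *)

Set Implicit Arguments.
Unset Strict Implicit.
Unset Printing Implicit Defensive.

Import Order.TTheory GRing.Theory Num.Theory.
Import numFieldNormedType.Exports.

Local Open Scope classical_set_scope.
Local Open Scope ring_scope.

(** * Operator norm estimates and the semigroup bound at time zero *)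

Section operator_bounds.
Context (R : realType) (X : normedModType R).

(** Rescale [x] to norm one. Boundedness of [A] is what makes the supremum in [opnorm] an upper
    bound, since [sup] of an unbounded set carries no information. *)
Lemma bounded_linear_opnorm (A : X -> X) (x : X) :
  bounded_linear A -> `|A x| <= opnorm A * `|x|.
Proof.
move=> [Alin [C AC]].
have Alin' a y : A (a *: y) = a *: A y.
  have A0 : A 0 = 0.
    have := Alin 1 0 0; rewrite !scale1r addr0 => /eqP.
    by rewrite -subr_eq0 opprD addrA subrr sub0r oppr_eq0 => /eqP.
  by have := Alin a y 0; rewrite A0 !addr0.
have [->|x0] := eqVneq x 0.
  by have := Alin' 0 0; rewrite !scale0r => ->; rewrite !normr0 mulr0.
have nx0 : 0 < `|x| by rewrite normr_gt0.
have -> : A x = `|x| *: A (`|x|^-1 *: x).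
  by rewrite Alin' scalerA mulfV ?gt_eqF// scale1r.
rewrite normrZ normr_id mulrC ler_wpM2r//.
apply: ub_le_sup; last first.
  exists (`|x|^-1 *: x) => //=.
  by rewrite normrZ normfV normr_id mulVf ?gt_eqF.
(* The constant [C] may be negative when [X] is trivial, hence the absolute value. *)
exists (`|C|) => _ [y /= y1 <-].
rewrite (le_trans (AC y))// (le_trans (ler_norm _))// normrM normr_id.
by rewrite ler_piMr.
Qed.

(** Let [t] tend to zero and use strong continuity. The conclusion amounts to [1 <= M] unless [X] is
    trivial, and extends to [t = 0] a bound known only for [t > 0]. *)
Lemma C0_semigroup_bound0 (V : R -> X -> X) (M : R) :
  C0_semigroup V ->
  (\forall t \near 0^'+, forall x : X, `|V t x| <= M * `|x|) ->
  forall x : X, `|x| <= M * `|x|.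
Proof.
move=> [_ _ _ V0] VM x.
have cV : `|V t x| @[t --> 0^'+] --> `|x| by apply: cvg_norm; exact: V0.
by apply: cvgr_to_le cV _; apply: filterS VM => t; apply.
Qed.

End operator_bounds.

(** * Norm bounds for Riemann integrals *)

Section riemann_integral_bound.
Context (R : realType).

(** Cut off pieces of length [delta / 2] until the rest is shorter than [delta]; the induction is on
    the number of pieces. *)
Lemma itv_partition_mesh (a b delta : R) : a <= b -> 0 < delta ->
  exists2 s : seq R, itv_partition a b s &
    forall i, (i < size s)%N -> s`_i - (a :: s)`_i < delta.
Proof.
move=> ab d0.
have [n nab] : exists n : nat, b - a <= n%:R * (delta / 2).
  have d2 : 0 < delta / 2 by rewrite divr_gt0.
  exists (Num.trunc ((b - a) / (delta / 2))).+1.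
  by rewrite -ler_pdivrMr// ltW// truncnS_gt.
elim: n a ab nab => [|n IH] a ab nab.
  exists [::] => //; split => //=; rewrite eq_le ab/=.
  by move: nab; rewrite mul0r subr_le0.
have [bad|dba] := ltP (b - a) delta.
  move: ab; rewrite le_eqVlt => /predU1P[->|ab].
    by exists [::] => //; split => //=.
  exists [:: b]; first exact: itv_partition1.
  by case.
have [||s [sp sb] ms] := IH (a + delta / 2).
- lra.
- by move: nab; rewrite -natr1; lra.
exists (a + delta / 2 :: s).
  split => //=; rewrite sp andbT; lra.
case=> [_|i]; rewrite /=; first lra.
by rewrite ltnS => /ms.
Qed.

Lemma itv_partition_nth_lt (a b : R) s i : itv_partition a b s ->
  (i < size s)%N -> (a :: s)`_i < s`_i.
Proof. by move=> [/(pathP 0)+ _]; exact. Qed.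

Lemma itv_partition_nth_itv (a b : R) s i : itv_partition a b s ->
  (i <= size s)%N -> a <= (a :: s)`_i <= b.
Proof.
move=> sab si; have si' : (i < (size s).+1)%N by rewrite ltnS.
have := itv_partition_nth_ge si' sab; have := itv_partition_nth_le si' sab.
by rewrite (set_nth_default 0)//= => -> ->.
Qed.

(* [W] plays the role of a primitive of [|f|]; it is only required to grow at
   least as fast as the left Riemann sums of [|f|]. *)
Lemma is_integral_norm_le (X : normedModType R) (a b : R) (f : R -> X) (I : X)
    (W : R -> R) : a <= b ->
  (forall s s', a <= s -> s < s' -> s' <= b ->
    (s' - s) * `|f s| <= W s' - W s) ->
  is_integral a b f I -> `|I| <= W b - W a.
Proof.
move=> ab fW fI; apply/ler_addgt0Pr => e e0.
have [delta d0 Hd] := fI e e0.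
have [s sab ms] := itv_partition_mesh ab d0.
have lsE i : (i < size s)%N -> (a :: s)`_i < s`_i.
  exact: itv_partition_nth_lt sab.
(* With tags at left endpoints, [f] is never evaluated at [b]. In the Gronwall argument the bound on
   the integrand is available only strictly before [b]. *)
have sumI := Hd s (fun i => (a :: s)`_i) sab ms.
have {}sumI : `|riemann_sum a s (fun i => (a :: s)`_i) f - I| < e.
  by apply: sumI => i /lsE/ltW ->; rewrite lexx.
have : `|riemann_sum a s (fun i => (a :: s)`_i) f| <= W b - W a.
  rewrite /riemann_sum (le_trans (ler_norm_sum _ _ _))//.
  rewrite (@le_trans _ _ (\sum_(i < size s) (W s`_i - W (a :: s)`_i)))//.
    apply: ler_sum => i _; have ai := lsE _ (ltn_ord i).
    rewrite normrZ ger0_norm ?subr_ge0 ?(ltW ai)//; apply: fW => //.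
      by have /andP[] := itv_partition_nth_itv sab (ltnW (ltn_ord i)).
    by have /andP[] := itv_partition_nth_itv sab (ltn_ord i).
  have -> : W b = W (a :: s)`_(size s).
    by rewrite (itv_partition_nth_size 0 sab).
  have := @telescope_sumr _ 0 (size s) (fun i => W (a :: s)`_i) (leq0n _).
  by rewrite big_mkord => ->.
move: sumI; set S := riemann_sum _ _ _ _ => SI SW.
have -> : I = S - (S - I) by rewrite opprB addrC subrK.
by rewrite (le_trans (ler_normB _ _))// lerD// ltW.
Qed.

End riemann_integral_bound.

(** * Gronwall's argument for mild solutions *)

Section mild_solution_bound.
Context (R : realType) (X : normedModType R).

(* Gronwall's argument by a first crossing time [T] of [|a|] with
   [C * expR (gamma * t)], [C > M * |a0|]. *)
Lemma mild_solution_norm_le (V : R -> X -> X) (N : X -> X) (M omega c : R)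
    (a0 : X) (a : R -> X) : 0 <= M -> 0 <= c ->
  (forall t x, 0 <= t -> `|V t x| <= M * expR (omega * t) * `|x|) ->
  (forall x, `|N x| <= c * `|x|) ->
  mild_solution V N a0 a ->
  forall t, 0 <= t -> `|a t| <= M * expR ((M * c + omega) * t) * `|a0|.
Proof.
move=> M0 c0 VM Nc [ca aE] t t0; set gamma := M * c + omega.
(* A strict inequality is needed for the crossing argument; the claim follows by letting [C]
   decrease to [M * |a0|]. The value of [C] used next makes the excess at time [t] exactly [e]. *)
suff strict C : M * `|a0| < C -> `|a t| < C * expR (gamma * t).
  rewrite mulrAC; apply/ler_addgt0Pr => e e0.
  have := strict (M * `|a0| + e / expR (gamma * t)).
  rewrite ltrDl divr_gt0 ?expR_gt0// => /(_ isT)/ltW.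
  by rewrite mulrDl divfK ?gt_eqF ?expR_gt0.
move=> MC.
have C0 : 0 < C by rewrite (le_lt_trans _ MC)// mulr_ge0.
pose S := [set s : R | 0 <= s /\ C * expR (gamma * s) <= `|a s|].
have [//|Cat] := ltP.
have S0 : S !=set0 by exists t.
have infS : has_inf S by split => //; exists 0 => s [].
pose T := inf S.
have T0 : 0 <= T by apply: lb_le_inf => // s [].
have before s : 0 <= s -> s < T -> `|a s| < C * expR (gamma * s).
  move=> s0 sT; rewrite ltNge; apply/negP => sS.
  by have := ge_inf infS.2 (conj s0 sS : S s); rewrite leNgt sT.
(* If the strict bound held at [T], it would persist on a neighbourhood of [T] in the half-line by
   continuity, whereas [S] has points arbitrarily close to its infimum. *)
have after : ~ `|a T| < C * expR (gamma * T).
  rewrite -subr_gt0 => aT.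
  have cp : (fun s => C * expR (gamma * s) - `|a s|) @ within `[0, +oo[ (nbhs T)
      --> C * expR (gamma * T) - `|a T|.
    apply: cvgB; last first.
      by apply: cvg_norm; move/subspace_continuousP : ca; apply; rewrite /= in_itv/= T0.
    apply: cvg_within_filter; apply: cvgM; first exact: cvg_cst.
    apply: continuous_comp; last exact: continuous_expR.
    by apply: cvgM; [exact: cvg_cst|exact: cvg_id].
  have /nbhs_ballP[r /= r0 Tr] : within `[0, +oo[ (nbhs T)
      (fun s => `|a s| < C * expR (gamma * s)).
    have WF : Filter (within `[0, +oo[ (nbhs T)) by exact: within_filter.
    have := cvgr_gt _ cp _ aT.
    by move=> /(_ WF); apply: filterS => s; rewrite subr_gt0.
  have [s [s0 Cs] sTr] := inf_adherent r0 infS.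
  have Ts : T <= s by exact: ge_inf infS.2 _ (conj s0 Cs).
  have : ball T r s by rewrite /ball/= distrC ger0_norm ?subr_ge0// ltrBlDl.
  by move=> /Tr; rewrite /= in_itv/= s0 => /(_ isT); rewrite ltNge Cs.
(* Duhamel's formula at [T], fed with the bound on earlier times, gives the strict inequality that
   [after] excludes. *)
suff : False by []; apply: after.
have [I aI ->] := aE _ T0.
(* Since [gamma = M * c + omega], the integrand at [s] is at most [M * expR (omega * (T - s)) * c *
   C * expR (gamma * s) = M * c * W s], which is the derivative of [W] at [s]. *)
pose W s := expR (omega * T) * (C * expR (M * c * s)).
have : `|I| <= W T - W 0.
  apply: is_integral_norm_le aI => // s s' s0 ss' s'T.
  have sT : s < T by exact: lt_le_trans s'T.
  have aas := before _ s0 sT.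
  have Mc0 : 0 <= M * c by rewrite mulr_ge0.
  have NVs : `|V (T - s) (N (a s))| <= M * c * W s.
    rewrite (le_trans (VM _ _ _)) ?subr_ge0 ?(ltW sT)//.
    have -> : M * c * W s = M * expR (omega * (T - s)) * (c * (C * expR (gamma * s))).
      rewrite /W /gamma mulrDl mulrBr !expRD expRN; field.
      by rewrite gt_eqF ?expR_gt0.
    rewrite ler_wpM2l ?mulr_ge0 ?expR_ge0// (le_trans (Nc _))//.
    by rewrite ler_wpM2l// ltW.
  rewrite (@le_trans _ _ ((s' - s) * (M * c * W s)))//.
    by rewrite ler_wpM2l// subr_ge0 ltW.
  have -> : W s' = W s * expR (M * c * (s' - s)).
    by rewrite /W -!mulrA -expRD; do 3 f_equal; ring.
  have W0 : 0 <= W s by rewrite /W !mulr_ge0 ?expR_ge0// ltW.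
  (* The inequality [1 + x <= expR x] replaces differentiation of [W]. *)
  have := ler_wpM2l W0 (expR_ge1Dx (M * c * (s' - s))); lra.
move=> IW; rewrite (le_lt_trans (ler_normD _ _))//.
rewrite (le_lt_trans (lerD (VM _ _ T0) IW))//.
(* The total is [expR (omega * T) * (M * |a0| - C) + C * expR (gamma * T)], whose first summand is
   negative. *)
rewrite /W mulr0 expR0 mulr1 /gamma mulrDl expRD.
have := expR_gt0 (omega * T); nra.
Qed.

End mild_solution_bound.

(** * Invariance of Lebesgue measure under translations and reflections *)

Lemma unconsrVK (R : realType) n : cancel (@unconsrV R n) (@consrV R n).
Proof.
move=> y; rewrite /consrV /unconsrV /=.
rewrite (_ : (y ord0 ord0)%:M = lsubmx (y : 'M[R]_(1, 1 + n))).
  exact: (@hsubmxK _ 1 1 n).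
apply/matrixP => i j; rewrite !ord1 !mxE mulr1n; congr (y _ _).
exact: val_inj.
Qed.

Section lebesgue_rV_invariance.
Context (R : realType).
Local Open Scope ereal_scope.

(** The image of Lebesgue measure under the map gives half-open intervals their length, so
    uniqueness identifies it with Lebesgue measure. The sign [s] treats [c + x] and [c - x]
    together; Young's inequality uses both. *)
Lemma ge0_integral_lebesgue_affine (s : bool) (c : R) (f : measurableTypeR R -> \bar R) :
  measurable_fun setT f -> (forall x, 0 <= f x) ->
  \int[@lebesgue_measure R]_x f (c + (-1) ^+ s * x)%R = \int[@lebesgue_measure R]_x f x.
Proof.
move=> mf f0; pose phi (x : measurableTypeR R) : measurableTypeR R := (c + (-1) ^+ s * x)%R.
have mphi : measurable_fun setT phi.
  apply: continuous_measurable_fun => x; apply: cvgD; first exact: cvg_cst.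
  by apply: cvgM; [exact: cvg_cst|exact: cvg_id].
transitivity (\int[pushforward (@lebesgue_measure R) phi]_x f x).
  by rewrite ge0_integral_pushforward.
apply: eq_measure_integral => A mA _; apply/esym.
pose nu : {measure set (measurableTypeR R) -> \bar R} :=
  measure_function_pushforward__canonical__measure_function_Measure
    (@lebesgue_measure R) mphi.
apply: (@lebesgue_measure_unique R nu) => // _ [[a b] _ <-] /=.
rewrite /nu /= /pushforward.
case: s @phi mphi @nu => phi mphi nu.
(* The reflection moves the closed end from right to left, which leaves the length unchanged. *)
- have -> : phi @^-1` `]a, b] = `[(c - b)%R, (c - a)%R[%classic.
    apply/seteqP; split=> x; rewrite /phi/= !in_itv/= expr1; lra.
  rewrite !lebesgue_measure_itv/= !lte_fin ltrD2l ltrN2.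
  by case: ifP => // _; rewrite -!EFinB; congr EFin; ring.
- have -> : phi @^-1` `]a, b] = `](a - c)%R, (b - c)%R]%classic.
    apply/seteqP; split=> x; rewrite /phi/= !in_itv/= expr0; lra.
  rewrite !lebesgue_measure_itv/= !lte_fin ltrD2r.
  by case: ifP => // _; rewrite -!EFinB; congr EFin; ring.
Qed.

Lemma ge0_integral_lebesgue_rVS n (f : 'rV[R]_n.+1 -> \bar R) :
  measurable_fun setT f -> (forall x, 0 <= f x) ->
  \int[lebesgue_rV R n.+1]_x f x =
  \int[@lebesgue_measure R]_t \int[lebesgue_rV R n]_x f (consrV (t, x)).
Proof.
move=> mf f0.
have mg := measurableT_comp mf (@measurable_consrV R n).
rewrite -(fubini_tonelli1 (f \o @consrV R n))//; last by move=> x; exact: f0.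
rewrite -[RHS](@ge0_integral_pushforward _ _ _ _ _ _ (@measurable_consrV R n) _ setT)//.
Qed.

(** By Tonelli, split off the first coordinate: the induction hypothesis handles the inner integral,
    the one-dimensional case the outer one. *)
Lemma ge0_integral_lebesgue_rV_affine n (s : bool) (c : 'rV[R]_n)
    (f : 'rV[R]_n -> \bar R) :
  measurable_fun setT f -> (forall x, 0 <= f x) ->
  \int[lebesgue_rV R n]_x f (c + (-1) ^+ s *: x)%R = \int[lebesgue_rV R n]_x f x.
Proof.
elim: n c f => [|n IH] c f mf f0.
  by apply: eq_integral => x _; rewrite (_ : (c + _)%R = x)//; apply/rowP => -[].
have maff m (b : 'rV[R]_m) : measurable_fun setT (fun x : 'rV[R]_m => b + (-1) ^+ s *: x)%R.
  apply: measurable_fun_rV => i.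
  under eq_fun do rewrite !mxE.
  apply: measurable_funD => //; apply: measurable_funM => //.
  exact: (@measurable_rV_coord R m i).
rewrite ge0_integral_lebesgue_rVS//; last exact: (measurableT_comp mf (maff _ c)).
rewrite [RHS]ge0_integral_lebesgue_rVS//.
pose c' := unconsrV c.
have cE t x : (c + (-1) ^+ s *: consrV (t, x))%R =
    consrV ((c'.1 + (-1) ^+ s * t)%R, (c'.2 + (-1) ^+ s *: x)%R).
  rewrite -[in LHS](unconsrVK c) /consrV. rewrite [X in (_ + X)%R](@scale_row_mx _ 1 1 n).
  rewrite [LHS](@add_row_mx _ 1 1 n)/=.
  by rewrite scale_scalar_mx raddfD.
under eq_integral => t _.
  under eq_integral do rewrite cE.
  rewrite (IH _ (fun x => f (consrV ((c'.1 + (-1) ^+ s * t)%R, x))))//; last first.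
    apply: (measurableT_comp (f := f) (g := fun x => consrV _)) => //.
    apply: (measurableT_comp (@measurable_consrV R n)).
    exact: pair1_measurable.
  over.
rewrite (ge0_integral_lebesgue_affine s c'.1 (f := fun t => \int[lebesgue_rV R n]_x f (consrV (t, x))))//.
- exact: (measurable_fun_fubini_tonelli_F (m2 := lebesgue_rV R n)
    (f \o @consrV R n) (measurableT_comp mf (@measurable_consrV R n)) (fun=> f0 _)).
- by move=> t; exact: integral_ge0.
Qed.

End lebesgue_rV_invariance.

(** * Borel measurability in the product sigma-algebra *)

Section borel_rV.
Context (R : realType) (n : nat).

(** An open set is the union of the countably many open cubes with rational centre and radius
    [1 / (m + 1)] that it contains, and each cube is a finite intersection of coordinate
    preimages. *)
Lemma open_measurable_rV (U : set 'rV[R]_n) : open U -> measurable U.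
Proof.
move=> oU; pose I := ('rV[rat]_n * nat)%type.
pose c (p : I) : 'rV[R]_n := map_mx ratr p.1.
pose B (p : I) : set 'rV[R]_n :=
  [set x | forall i, ball (c p ord0 i) p.2.+1%:R^-1 (x ord0 i)].
have mB p : measurable (B p).
  rewrite (_ : B p = \bigcap_(i in [set: 'I_n])
      (@rV_coord R n i @^-1` ball (c p ord0 i) p.2.+1%:R^-1)); last first.
    by apply/seteqP; split=> [x Bx i _|x Bx i]; exact: Bx.
  apply: fin_bigcap_measurable => // i _; rewrite -[X in measurable X]setTI.
  by apply: measurable_rV_coord => //; apply: open_measurable; exact: ball_open.
rewrite (_ : U = \bigcup_(p : I) (if `[< B p `<=` U >] then B p else set0)).
  apply: countable_bigcupT_measurable; first exact: countableP.
  by move=> p; case: ifP.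
apply/seteqP; split=> [x Ux|x [p _]]; last by case: ifPn => // /asboolP; exact.
have /nbhs_ballP[e /= e0 xeU] : nbhs x U by exact: open_nbhs_nbhs.
have e20 : 0 < e / 2 by rewrite divr_gt0.
pose m := Num.trunc (e / 2)^-1.
(* A cube of this radius that contains [x] has all its points within [e] of [x]. *)
have me : m.+1%:R^-1 < e / 2.
  by rewrite invf_plt ?posrE ?ltr0n// truncnS_gt.
have m0 : 0 < m.+1%:R^-1 :> R by rewrite invr_gt0 ltr0n.
have qP (i : 'I_n) : exists q : rat, ball (x ord0 i) m.+1%:R^-1 (ratr q : R).
  have [q] : exists q : rat, (ratr q : R) \in `](x ord0 i), (x ord0 i + m.+1%:R^-1)[.
    by apply: rat_in_itvoo; rewrite ltrDl.
  rewrite in_itv/= => /andP[q1 q2]; exists q.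
  by rewrite /ball/= distrC ger0_norm ?subr_ge0 1?ltW// ltrBlDl.
pose q i := projT1 (cid (qP i)).
exists (\row_i q i, m) => //=.
have cE i : c (\row_i q i, m) ord0 i = ratr (q i) by rewrite /c !mxE.
case: ifPn => [_ i|/asboolP[y By]].
  by rewrite cE; apply: ball_sym; exact: projT2 (cid (qP i)).
apply: xeU; split => // i j; rewrite ord1.
have xq := projT2 (cid (qP j)); have /= := By j; rewrite cE => qy.
apply: le_ball (ball_triangle xq qy).
by rewrite (splitr e) lerD// ltW.
Qed.

Lemma continuous_measurable_rV (f : 'rV[R]_n -> R) :
  continuous f -> measurable_fun setT f.
Proof.
move=> /continuousP cf.
apply: (measurability _ (RGenOpens.measurableE R)) => _ [_ [a [b ->] <-]].
by rewrite setTI; apply: open_measurable_rV; exact/cf/interval_open.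
Qed.

End borel_rV.

(** * Integrability of Schwartz functions *)

Section schwartz_integrable.
Context (R : realType).

Let oneDsqr_gt0 (x : R) : 0 < oneDsqr x.
Proof. exact: lt_le_trans ltr01 (oneDsqr_ge1 x). Qed.

Lemma integral_oneDsqr_lty :
  (\int[@lebesgue_measure R]_x (oneDsqr x)^-1%:E < +oo)%E.
Proof.
rewrite ge0_symfun_integralT//=.
- rewrite (_ : [set x | _] = `[0, +oo[%classic); last first.
    by apply/seteqP; split => x/=; rewrite in_itv/= andbT.
  by rewrite integral0y_oneDsqr -EFinM ltry.
- exact: continuous_oneDsqrV.
- by move=> x; rewrite /= /oneDsqr sqrrN.
Qed.

Lemma integral_prod_rV_lty n (f : R -> R) : measurable_fun setT f ->
  (forall x, 0 <= f x) -> (\int[@lebesgue_measure R]_x (f x)%:E < +oo)%E ->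
  (\int[lebesgue_rV R n]_x (\prod_i f (x ord0 i))%:E < +oo)%E.
Proof.
move=> mf f0 foo.
have mprod m : measurable_fun setT (fun x : 'rV[R]_m => \prod_i f (x ord0 i)).
  apply: measurable_prod => i _.
  exact: measurableT_comp mf (@measurable_rV_coord R m i).
have prod0 m (x : 'rV[R]_m) : 0 <= \prod_i f (x ord0 i) by exact: prodr_ge0.
elim: n => [|n IH].
  under eq_integral do rewrite big_ord0.
  by rewrite integral_cst//= mul1e diracT ltry.
rewrite ge0_integral_lebesgue_rVS//; last 2 first.
- by apply/measurable_EFinP; exact: mprod.
- by move=> x; rewrite lee_fin.
have consE t (x : 'rV[R]_n) :
    \prod_i f (consrV (t, x) ord0 i) = f t * \prod_i f (x ord0 i).
  rewrite big_ord_recl; congr (f _ * _).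
    exact: (congr1 fst (consrVK (t, x))).
  apply: eq_bigr => i _; congr f.
  rewrite /consrV (_ : lift ord0 i = rshift 1 i); last exact: val_inj.
  by rewrite (@row_mxEr _ 1 1 n).
under eq_integral => t _.
  under eq_integral do rewrite consE EFinM.
  rewrite ge0_integralZl_EFin//; last 2 first.
  - by move=> x _; rewrite lee_fin.
  - by apply/measurable_EFinP; exact: mprod.
  over.
have prodI0 : (0 <= \int[lebesgue_rV R n]_x (\prod_i f (x ord0 i))%:E)%E.
  by apply: integral_ge0 => x _; rewrite lee_fin.
have fI0 : (0 <= \int[@lebesgue_measure R]_x (f x)%:E)%E.
  by apply: integral_ge0 => x _; rewrite lee_fin.
rewrite ge0_integralZr//.
- by rewrite muleC lte_mul_pinfty// ge0_fin_numE.
- exact/measurable_EFinP.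
- by move=> x _; rewrite lee_fin.
Qed.

(* Expanding the product of the [1 + x_i ^ 2] leaves one monomial weight for each
   set [J] of coordinates. *)
Lemma schwartz_decay n (k : 'rV[R]_n -> R) : schwartz k ->
  exists C : R, forall x, `|k x| <= C * \prod_i (oneDsqr (x ord0 i))^-1.
Proof.
move=> [_ kS].
(* [J] is the set of coordinates from which the expansion picks the summand [1]. The empty list of
   derivatives selects the seminorms of [k] itself. *)
have /choice[C CP] (J : {set 'I_n}) : exists C : R, forall x : 'rV[R]_n,
    `|(\prod_i x ord0 i ^+ (if i \in J then 0 else 2)) * k x| <= C.
  exact: (kS (fun i => if i \in J then 0%N else 2%N) [::]).
exists (\sum_(J : {set 'I_n}) C J) => x.
have P0 : 0 < \prod_i oneDsqr (x ord0 i) by apply: prodr_gt0 => i _; exact: oneDsqr_gt0.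
rewrite prodfV ler_pdivlMr// mulrC -[X in X * _]gtr0_norm// -normrM.
rewrite /oneDsqr bigA_distr/= mulr_suml (le_trans (ler_norm_sum _ _ _))//.
apply: ler_sum => J _; rewrite (le_trans _ (CP J x))// le_eqVlt; apply/orP; left.
apply/eqP; congr `|_ * _|; apply: eq_bigr => i _.
by case: ifP; rewrite ?expr0.
Qed.

Lemma schwartz_measurable n (k : 'rV[R]_n -> R) : schwartz k ->
  measurable_fun setT k.
Proof. by move=> [/(_ [::])[kc _] _]; exact: continuous_measurable_rV. Qed.

(** Domination by the product of the weights [1 / (1 + x_i ^ 2)], whose integral factors into
    one-dimensional ones. *)
Lemma schwartz_integrable n (k : 'rV[R]_n -> R) : schwartz k ->
  (lebesgue_rV R n).-integrable setT (EFin \o k).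
Proof.
move=> kS; have mk := schwartz_measurable kS.
have [C kC] := schwartz_decay kS.
apply/integrableP; split; first exact/measurable_EFinP.
have mP : measurable_fun setT (fun x : 'rV[R]_n => \prod_i (oneDsqr (x ord0 i))^-1).
  apply: measurable_prod => i _.
  apply: (measurableT_comp (f := fun t : R => (oneDsqr t)^-1)); last exact: measurable_rV_coord.
  by apply: continuous_measurable_fun; exact: continuous_oneDsqrV.
apply: (@le_lt_trans _ _ (\int[lebesgue_rV R n]_x
    (`|C|%:E * (\prod_i (oneDsqr (x ord0 i))^-1)%:E))%E).
  apply: ge0_le_integral => //=.
  - apply/measurable_EFinP; exact: measurableT_comp.
  - by apply/measurable_EFinP; exact: measurable_funM.
  - move=> x _; rewrite lee_fin (le_trans (kC x))// ler_wpM2r ?ler_norm//.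
    by apply: prodr_ge0 => i _; rewrite invr_ge0 ?(ltW (oneDsqr_gt0 _)).
rewrite ge0_integralZl_EFin//; last 2 first.
  by move=> x _; rewrite lee_fin; apply: prodr_ge0 => i _; rewrite invr_ge0 ?(ltW (oneDsqr_gt0 _)).
  exact/measurable_EFinP.
apply: lte_mul_pinfty => //.
apply: (@integral_prod_rV_lty _ (fun t => (oneDsqr t)^-1)).
- by apply: continuous_measurable_fun; exact: continuous_oneDsqrV.
- by move=> t; rewrite invr_ge0 ?(ltW (oneDsqr_gt0 _)).
- exact: integral_oneDsqr_lty.
Qed.

End schwartz_integrable.

(** * Cauchy-Schwarz with a weight *)

Section weighted_cauchy_schwarz.
Local Open Scope ereal_scope.
Context d (T : measurableType d) (R : realType).
Variable mu : {measure set T -> \bar R}.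

(** Hoelder's inequality with both exponents [2] for [sqrt |w|] and [sqrt |w| * |b|]. Extended real
    values let it be applied before the right-hand side is known to be finite. *)
Lemma integral_norm_cauchy_schwarz (w b : T -> R) :
  measurable_fun setT w -> measurable_fun setT b ->
  (\int[mu]_x (`|w x| * `|b x|)%:E) `^ 2 <=
  (\int[mu]_x `|w x|%:E) * \int[mu]_x (`|w x| * b x ^+ 2)%:E.
Proof.
move=> mw mb.
have mnw : measurable_fun setT (fun x => `|w x|%R) by exact: measurableT_comp.
have mnb : measurable_fun setT (fun x => `|b x|%R) by exact: measurableT_comp.
pose f x := Num.sqrt `|w x|; pose g x := (Num.sqrt `|w x| * `|b x|)%R.
have mf : measurable_fun setT f.
  apply: measurableT_comp mnw.
  by apply: continuous_measurable_fun; exact: sqrt_continuous.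
have mg : measurable_fun setT g by exact: measurable_funM.
have sq x : (Num.sqrt `|w x| ^+ 2 = `|w x|)%R by rewrite sqr_sqrtr.
have f0 x : (0 <= f x)%R by exact: sqrtr_ge0.
have g0 x : (0 <= g x)%R by rewrite mulr_ge0 ?sqrtr_ge0.
have half : (2^-1 + 2^-1 = 1 :> R)%R by rewrite -[RHS](@mulfV _ 2%R)//; ring.
have := hoelder mu mf mg (ltr0n _ 2) (ltr0n _ 2) half.
rewrite Lnorm1.
have -> : \int[mu]_x `|(EFin \o (f \* g)%R) x| = \int[mu]_x (`|w x| * `|b x|)%:E.
  apply: eq_integral => x _ /=; rewrite ger0_norm ?mulr_ge0//.
  by rewrite /f /g mulrA -expr2 sq.
move=> fg.
have {}fg : (\int[mu]_x (`|w x| * `|b x|)%:E) `^ 2 <=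
    ('N[mu]_2%:E[EFin \o f] * 'N[mu]_2%:E[EFin \o g]) `^ 2.
  apply: gt0_ler_poweR fg => //.
    by rewrite in_itv/= leey andbT; apply: integral_ge0 => x _; rewrite lee_fin mulr_ge0.
  by rewrite in_itv/= leey andbT mule_ge0// Lnorm_ge0.
apply: le_trans fg _; rewrite poweRM ?Lnorm_ge0//.
rewrite !poweR_Lnorm// le_eqVlt; apply/orP; left; apply/eqP.
congr (_ * _); apply: eq_integral => x _; rewrite /= ?poweR_EFin powR_mulrn//.
- by rewrite ger0_norm// sq.
- by rewrite ger0_norm// /g exprMn sq real_normK// num_real.
Qed.

End weighted_cauchy_schwarz.

(** * Norm estimates in [L2] and Young's inequality *)

Section L2_bounds.
Context (R : realType) (d : nat).
Local Notation leb := (lebesgue_rV R d).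
Implicit Types (u : L2 R d) (k : 'rV[R]_d -> R).

Lemma L2fun_measurable u : measurable_fun setT (L2fun u).
Proof. exact: (@measurable_funPT _ _ _ _ (Lrepr u)). Qed.

Lemma L2_norm_sqr u : (`|u| ^+ 2)%:E = (\int[leb]_x (L2fun u x ^+ 2)%:E)%E.
Proof.
have fu : 'N[leb]_2%:E[EFin \o L2fun u]%E \is a fin_num.
  by rewrite ge0_fin_numE ?Lnorm_ge0//; exact: (@Lebesgue_finite _ _ _ _ _ _ u).
rewrite -[`|u|]/(fine 'N[leb]_2%:E[EFin \o L2fun u]) -powR_mulrn; last first.
  by rewrite fine_ge0// Lnorm_ge0.
rewrite -poweR_EFin fineK// poweR_Lnorm//; apply: eq_integral => x _ /=.
by rewrite ?poweR_EFin powR_mulrn// real_normK// num_real.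
Qed.

(** When [h] has no class in [L2], the default value [0] of [toL2] satisfies the bound because
    [0 <= C]. Norm estimates therefore do not require a membership proof. *)
Lemma toL2_norm_le (h : 'rV[R]_d -> R) (C : R) : 0 <= C ->
  (forall u, h = L2fun u %[ae leb] -> `|u| <= C) -> `|toL2 h| <= C.
Proof.
move=> C0 hC; rewrite /toL2; case: xgetP => [v _ /= /hC //|_].
by rewrite normr0.
Qed.

Lemma toL2_comp_norm_le (g : R -> R) (L : R) u : 0 <= L ->
  (forall x, `|g x| <= L * `|x|) -> `|toL2 (g \o L2fun u)| <= L * `|u|.
Proof.
move=> L0 gL; apply: toL2_norm_le => [|v vE]; first by rewrite mulr_ge0.
rewrite -(@ler_pXn2r _ 2)// ?nnegrE ?mulr_ge0// -lee_fin exprMn [leRHS]EFinM !L2_norm_sqr.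
have m2 (w : L2 R d) : measurable_fun setT (fun x => (L2fun w x ^+ 2)%:E).
  by apply/measurable_EFinP; apply: measurable_funX; exact: L2fun_measurable.
rewrite -ge0_integralZl_EFin//; last 2 first.
- by move=> x _; rewrite lee_fin sqr_ge0.
- by rewrite exprn_ge0.
apply: ae_ge0_le_integral => //.
- by move=> x _; rewrite lee_fin sqr_ge0.
- by move=> x _; rewrite -EFinM lee_fin mulr_ge0 ?sqr_ge0.
- exact: measurable_funeM.
apply: filterS vE => x /= vE _; rewrite -vE// lee_fin -exprMn.
by rewrite -real_normK ?num_real// -[leRHS]real_normK ?num_real//
  ler_pXn2r ?nnegrE// normrM (ger0_norm L0).
Qed.

(* Young's inequality: Cauchy-Schwarz for the measure [|k (x - y)| dy], then
   Tonelli's theorem. *)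
Lemma K_op_norm_le k (b : L2 R d) : leb.-integrable setT (EFin \o k) ->
  `|K_op k b| <= L1norm k * `|b|.
Proof.
move=> /integrableP[/measurable_EFinP mk koo].
have mb := L2fun_measurable b.
set K := L1norm k.
have KE : (K%:E = \int[leb]_x `|k x|%:E)%E.
  rewrite /K /L1norm Lnorm1 fineK// ge0_fin_numE//.
  exact: integral_ge0.
have K0 : 0 <= K by rewrite -lee_fin KE; apply: integral_ge0.
have mnk : measurable_fun setT (fun x => `|k x|%:E).
  by apply/measurable_EFinP; exact: measurableT_comp.
(* Integrating in [y] uses the reflection [x - y]; integrating in [x], as in [intk_r], uses a
   translation. *)
have intk_l x : (\int[leb]_y `|k (x - y)%R|%:E = K%:E)%E.
  rewrite KE -(ge0_integral_lebesgue_rV_affine true x mnk)//.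
  by apply: eq_integral => y _; rewrite expr1 scaleN1r.
have intk_r y : (\int[leb]_x `|k (x - y)%R|%:E = K%:E)%E.
  rewrite KE -(ge0_integral_lebesgue_rV_affine false (- y) mnk)//.
  by apply: eq_integral => x _; rewrite expr0 scale1r addrC.
pose P := ('rV[R]_d * 'rV[R]_d)%type.
have msub : measurable_fun setT (fun z : P => z.1 - z.2).
  apply: measurable_fun_rV => i; under eq_fun do rewrite !mxE.
  apply: measurable_funB.
    exact: (measurableT_comp (@measurable_rV_coord R d i) measurable_fst).
  exact: (measurableT_comp (@measurable_rV_coord R d i) measurable_snd).
have msubx x : measurable_fun setT (fun y : 'rV[R]_d => x - y).
  exact: (measurableT_comp msub (@pair1_measurable _ _ _ _ x)).
have msuby y : measurable_fun setT (fun x : 'rV[R]_d => x - y).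
  exact: (measurableT_comp msub (@pair2_measurable _ _ _ _ y)).
pose F (z : P) : \bar R := (`|k (z.1 - z.2)| * L2fun b z.2 ^+ 2)%:E.
have mF : measurable_fun setT F.
  apply/measurable_EFinP; apply: measurable_funM.
    apply: (measurableT_comp (f := fun x : R => `|x|)) => //.
    exact: (measurableT_comp mk msub).
  by apply: measurable_funX; exact: (measurableT_comp mb measurable_snd).
have F0 z : (0 <= F z)%E by rewrite lee_fin mulr_ge0// sqr_ge0.
apply: toL2_norm_le => [|u uE]; first by rewrite mulr_ge0.
rewrite -(@ler_pXn2r _ 2)// ?nnegrE ?mulr_ge0// -lee_fin L2_norm_sqr.
(* Cauchy-Schwarz in [y] bounds the square of the convolution at [x] by [K] times the integral of
   [F (x, y)]. Tonelli then yields a second factor [K]. *)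
apply: (@le_trans _ _ (\int[leb]_x (K%:E * \int[leb]_y F (x, y)))%E).
  apply: ae_ge0_le_integral => //.
  - by move=> x _; rewrite lee_fin sqr_ge0.
  - by apply/measurable_EFinP; apply: measurable_funX; exact: L2fun_measurable.
  - by move=> x _; rewrite mule_ge0// integral_ge0.
  - apply: measurable_funeM.
    exact: (measurable_fun_fubini_tonelli_F (m2 := leb) F mF F0).
  apply: filterS uE => x /= uE _; rewrite -uE//.
  have mkx : measurable_fun setT (fun y : 'rV[R]_d => k (x - y)).
    exact: (measurableT_comp mk (msubx x)).
  have := integral_norm_cauchy_schwarz leb mkx mb.
  rewrite intk_l; apply: le_trans.
  set G := (\int[leb]_y (`|k (x - y)| * `|L2fun b y|)%:E)%E.
  have convG : (`|convolution k (L2fun b) x|%:E <= G)%E.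
    rewrite /convolution /Rintegral.
    apply: (@le_trans _ _ `|\int[leb]_y (k (x - y) * L2fun b y)%:E|%E).
      (* If the extended integral were infinite, the real-valued one would be [0] by convention and
         the inequality would still hold. *)
      by case: (integral _ _ _) => //= *; rewrite normr0 leey.
    apply: (le_trans (le_abse_integral _ _ _)) => //.
      by apply/measurable_EFinP; exact: measurable_funM.
    by under eq_integral do rewrite abse_EFin normrM.
  have := gt0_ler_poweR (ler0n R 2) _ _ convG.
  rewrite !in_itv/= !leey !andbT lee_fin normr_ge0 (le_trans _ convG) ?lee_fin//.
  by rewrite powR_mulrn// real_normK ?num_real//; apply.
rewrite ge0_integralZl_EFin//; last 2 first.
- by move=> x _; exact: integral_ge0.
- exact: (measurable_fun_fubini_tonelli_F (m2 := leb) F mF F0).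
rewrite (fubini_tonelli F mF F0).
under eq_integral => y _.
  under eq_integral => x _ do rewrite /F /= mulrC EFinM.
  rewrite ge0_integralZl_EFin//; last 2 first.
  - by apply/measurable_EFinP; apply: measurableT_comp => //; exact: (measurableT_comp mk (msuby y)).
  - by rewrite sqr_ge0.
  rewrite intk_r.
  over.
rewrite ge0_integralZr//; last 2 first.
- by apply/measurable_EFinP; apply: measurable_funX.
- by move=> x _; rewrite lee_fin sqr_ge0.
by rewrite -L2_norm_sqr -!EFinM lee_fin exprMn mulrCA mulrA expr2 [_ * K]mulrC; lra.
Qed.

End L2_bounds.

(** * The least Lipschitz constant *)

Section lipschitz_constant.
Context (R : realType).
Implicit Types f g : R -> R.

Lemma lipschitz_constant_ge0 f : 0 <= lipschitz_constant f.
Proof.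
rewrite /lipschitz_constant; set S := [set _ | _].
have [S0|/set0P/negP/negPn/eqP->] := pselect (S !=set0); last by rewrite inf0.
by apply: lb_le_inf => // L [].
Qed.

(** The infimum is attained: every difference quotient is a lower bound of the set of Lipschitz
    constants, which is nonempty. *)
Lemma lipschitz_constantP f : lipschitz f ->
  forall x y, `|f x - f y| <= lipschitz_constant f * `|x - y|.
Proof.
move=> flip x y.
(* [lipschitz] provides constants near infinity; the absolute value of one of them lies in the set
   of nonnegative constants. *)
have [L fL] : exists L : R, 0 <= L /\ L.-lipschitz f.
  have [L fL] := @filter_ex _ (pinfty_nbhs R) _ _ flip; exists `|L|; split => //.
  move=> [u v] uv; apply: (le_trans (fL _ uv)).
  by rewrite ler_wpM2r// ler_norm.
have [->|xy] := eqVneq x y; first by rewrite !subrr normr0 mulr0.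
rewrite -ler_pdivrMr ?normr_gt0 ?subr_eq0//.
apply: lb_le_inf; first by exists L.
move=> K [_ fK]; rewrite ler_pdivrMr ?normr_gt0 ?subr_eq0//.
exact: (fK (x, y)).
Qed.

Lemma lipschitz_subid f g : (forall x, f x = x + g x) -> lipschitz f -> lipschitz g.
Proof.
move=> fE flip; have [L fL] := @filter_ex _ (pinfty_nbhs R) _ _ flip.
apply: (@klipschitzW _ _ _ (L + 1)); first exact: (@globally_properfilter _ _ (0, 0)).
move=> [x y] /= xy; have : `|f x - f y| <= L * `|x - y| by exact: (fL (x, y)).
  rewrite !fE mulrDl mul1r => fxy.
have -> : g x - g y = (x + g x - (y + g y)) - (x - y) by ring.
by rewrite (le_trans (ler_normB _ _))// lerD2r.
Qed.

End lipschitz_constant.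

(** * The nonlinearity and the exponential decay *)

Lemma N_op_norm_le (R : realType) (d : nat) (mu L : R) (k : 'rV[R]_d -> R)
    (g : R -> R) (u : L2 R d) :
  0 <= mu -> 0 <= L -> schwartz k -> (forall x, `|g x| <= L * `|x|) ->
  `|N_op mu k g u| <= mu * L1norm k * L * `|u|.
Proof.
move=> mu0 L0 kS gL; rewrite /N_op normrZ (ger0_norm mu0) -!mulrA ler_wpM2l//.
rewrite (le_trans (K_op_norm_le _ (schwartz_integrable kS)))// ler_wpM2l//.
  by rewrite fine_ge0// Lnorm_ge0.
exact: toL2_comp_norm_le.
Qed.

Theorem mainTheorem3 (R : realType) (d : nat) (d_gt0 : (0 < d)%N)
  (alpha mu : R) (alpha_gt0 : 0 < alpha) (mu_gt0 : 0 < mu)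
  (k : 'rV[R]_d -> R) (k_schwartz : schwartz k)
  (kappa : 'rV[R]_d -> R[i])
  (kappaE : kappa = fourier (fun x => (k x)%:C%C))
  (kappa_star : R)
  (kappa_starE : kappa_star = sup [set complex.Re (kappa xi) | xi in setT])
  (kappa_star_lt : 0 < 2 * alpha - mu * kappa_star)
  (E : set 'rV[R]_d) (mE : lebesgue_measurable E) (E_thick : thick E)
  (f : R -> R) (f_C1 : is_C1 f) (f_lip : lipschitz f)
  (f0 : f 0 = 0) (df0 : derive1 f 0 = 1)
  (g : R -> R) (fE : forall theta, f theta = theta + g theta)
  (Lambda : R) (LambdaE : Lambda = lipschitz_constant g)
  (F : L2 R d -> L2 R d) (F_bounded : bounded_linear F)
  (V : R -> L2 R d -> L2 R d)
  (V_semigroup : semigroup_generated_by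
     (fun a => B_op alpha mu k a + indicator_op E (F a)) V)
  (M omega : R) (M_gt0 : 0 < M) (omega_lt0 : omega < 0)
  (V_stable : forall t, 0 < t -> opnorm (V t) <= M * expR (omega * t))
  (gamma : R) (gammaE : gamma = M * mu * L1norm k * Lambda + omega)
  (gamma_lt0 : gamma < 0)
  (a0 : L2 R d) (a : R -> L2 R d)
  (a_mild : mild_solution V (N_op mu k g) a0 a) :
  forall t : R, 0 < t -> `|a t| <= M * expR (gamma * t) * `|a0|.
Proof.
have glip : lipschitz g by exact: lipschitz_subid fE f_lip.
have g0 : g 0 = 0 by have := fE 0; rewrite f0 add0r.
have gL x : `|g x| <= Lambda * `|x|.
  by have := lipschitz_constantP glip x 0; rewrite g0 !subr0 LambdaE.
have Lambda0 : 0 <= Lambda by rewrite LambdaE lipschitz_constant_ge0.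
have [V_C0 _] := V_semigroup.
have V_le t x : 0 < t -> `|V t x| <= M * expR (omega * t) * `|x|.
  move=> t0; have [V_lin _ _ _] := V_C0.
  rewrite (le_trans (bounded_linear_opnorm _ (V_lin _ (ltW t0))))//.
  by rewrite ler_wpM2r// V_stable.
(* [V_stable] says nothing at [t = 0]. As [omega < 0], the norms are at most [M * |x|] for all
   [t > 0], and the limit at zero supplies the missing case. *)
have M_ge x : `|x : L2 R d| <= M * `|x|.
  apply: C0_semigroup_bound0 V_C0 _ x; near=> t => x.
  have t0 : 0 < t by [].
  rewrite (le_trans (V_le _ _ t0))// ler_wpM2r// ler_piMr ?(ltW M_gt0)//.
  by rewrite -expR0 ler_expR mulr_le0_ge0 ?ltW.
have {}V_le t x : 0 <= t -> `|V t x| <= M * expR (omega * t) * `|x|.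
  rewrite le_eqVlt => /predU1P[<-|]; last exact: V_le.
  by have [_ -> _ _] := V_C0; rewrite mulr0 expR0 mulr1.
move=> t t0; rewrite gammaE -!mulrA.
have c0 : 0 <= mu * L1norm k * Lambda.
  by rewrite !mulr_ge0 ?(ltW mu_gt0)// fine_ge0// Lnorm_ge0.
have := mild_solution_norm_le (ltW M_gt0) c0 V_le
  (fun u => N_op_norm_le u (ltW mu_gt0) Lambda0 k_schwartz gL) a_mild (ltW t0).
by rewrite !mulrA.
Unshelve. all: by end_near. Qed.
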